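(* Let $\mathbb{T}_1,\mathbb{T}_2$ be time scales, $a_1\in\mathbb{T}_1$, $a_2\in\mathbb{T}_2$, $\tilde{\mathbb{T}}_1=[a_1,\infty)\cap\mathbb{T}_1$, $\tilde{\mathbb{T}}_2=[a_2,\infty)\cap\mathbb{T}_2$. Let $u(t_1,t_2),a(t_1,t_2)\in C(\tilde{\mathbb{T}}_1\times\tilde{\mathbb{T}}_2,\mathbb{R}_0^+)$ with $a(t_1,t_2)$ nondecreasing in each of the variables, and let $f(t_1,t_2,s_1,s_2)\in C(S,\mathbb{R}_0^+)$ be nondecreasing in $t_1$ and $t_2$, where $S=\{(t_1,t_2,s_1,s_2)\in\tilde{\mathbb{T}}_1\times\tilde{\mathbb{T}}_2\times\tilde{\mathbb{T}}_1\times\tilde{\mathbb{T}}_2:a_1\le s_1\le t_1,\ a_2\le s_2\le t_2\}$. If $$u(t_1,t_2)\le a(t_1,t_2)+\int_{a_1}^{t_1}\int_{a_2}^{t_2}f(t_1,t_2,s_1,s_2)u(s_1,s_2)\Delta_1s_1\Delta_2s_2$$ for $(t_1,t_2)\in\tilde{\mathbb{T}}_1\times\tilde{\mathbb{T}}_2$, then for all $(t_1,t_2)\in\tilde{\mathbb{T}}_1\times\tilde{\mathbb{T}}_2$ $$u(t_1,t_2)\le a(t_1,t_2)\,e_{p}(t_1,a_1),\qquad\text{where } p(\tau)=p_{t_1,t_2}(\tau)=\int_{a_2}^{t_2}f(t_1,t_2,\tau,s_2)\Delta_2s_2,\quad \tau\in[a_1,t_1]\cap\mathbb{T}_1 .$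$
   Context: $\mathbb{R}_0^+=[0,\infty)$. A time scale is a nonempty closed subset of $\mathbb{R}$, with $\sigma(t)=\inf\{s\in\mathbb{T}:s>t\}$, $\mu(t)=\sigma(t)-t$. $y^\Delta(t)$ is the $\Delta$-derivative: for each $\varepsilon>0$, $|y(\sigma(t))-y(s)-y^\Delta(t)(\sigma(t)-s)|\le\varepsilon|\sigma(t)-s|$ for $s$ near $t$. $\int_c^df\Delta t=F(d)-F(c)$ with $F^\Delta=f$; $\Delta_1,\Delta_2$ refer to $\mathbb{T}_1,\mathbb{T}_2$ (with $s_1$ ranging over $[a_1,t_1)$ and $s_2$ over $[a_2,t_2)$). For an rd-continuous function $p$ with $1+\mu(t)p(t)\ne0$, $e_p(\cdot,t_0)$ is the unique solution of $y^\Delta=p(t)y$, $y(t_0)=1$; here it is taken on $\mathbb{T}_1$ in the variable $\tau$, with $t_1,t_2$ in $p_{t_1,t_2}$ held fixed. *)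

(* Defs.v *)
From HB Require Import structures.
From mathcomp Require Import all_boot all_order all_algebra.
From mathcomp Require Import all_classical all_reals all_analysis.

Set Implicit Arguments.
Unset Strict Implicit.
Unset Printing Implicit Defensive.

Import Order.TTheory GRing.Theory Num.Theory.
Import numFieldNormedType.Exports.

Local Open Scope classical_set_scope.
Local Open Scope ring_scope.

Definition time_scale (R : realType) (T : set R) : Prop :=
  T !=set0 /\ closed T.

(* Convention inf set0 := sup T, so that sigma fixes the maximum of T, if any
   (the library's own inf set0 is 0). *)
Definition sigma (R : realType) (T : set R) (t : R) : R :=
  let above := [set s | T s /\ t < s] in
  if `[< above !=set0 >] then inf above else sup T.

(* l is the Delta-derivative of y at t in T; only the values of y on T matter.
   It is unique unless t is a left-scattered maximum of T. *)
Definition is_delta_deriv (R : realType) (T : set R) (y : R -> R) (t l : R)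
    : Prop :=
  forall eps : R, 0 < eps ->
    \forall s \near t, T s ->
      `|y (sigma T t) - y s - l * (sigma T t - s)|
        <= eps * `|sigma T t - s|.

Definition ts_from (R : realType) (T : set R) (a : R) : set R :=
  T `&` `[a, +oo[.

Definition ts_seg (R : realType) (T : set R) (c d : R) : set R :=
  T `&` `[c, d].

(* y^Delta = g on [c, d), the derivative being taken in the time scale
   [c, d] /\ T because y and g need not be defined elsewhere; this does not
   change sigma on [c, d).  Delta-differentiability gives continuity at every
   point but d, so continuity is asked for in order to determine y d. *)
Definition delta_primitive (R : realType) (T : set R) (c d : R)
    (g y : R -> R) : Prop :=
  {within ts_seg T c d, continuous y} /\
  forall t, T t -> c <= t -> t < d -> is_delta_deriv (ts_seg T c d) y t (g t).

(* The integral of g from c to d, for c <= d in T (0 if g has no primitive). *)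
Definition delta_int (R : realType) (T : set R) (g : R -> R) (c d : R) : R :=
  xget 0 [set v | exists F : R -> R,
                    delta_primitive T c d g F /\ v = F d - F c].

(* e_p(t, t0) for t0 <= t in T: the value at t of the solution on [t0, t] of
   y^Delta = p y, y t0 = 1 (0 if there is no solution); p is meant to be
   rd-continuous with 1 + mu p nonvanishing. *)
Definition delta_exp (R : realType) (T : set R) (p : R -> R) (t t0 : R) : R :=
  xget 0 [set v | exists y : R -> R,
                    [/\ delta_primitive T t0 t (fun s => p s * y s) y,
                        y t0 = 1 & v = y t]].

Definition kernel_domain (R : realType) (T1 T2 : set R) (a1 a2 : R)
    : set (R * R * R * R) :=
  [set z | let: (t1, t2, s1, s2) := z in
     [/\ ts_from T1 a1 t1, ts_from T2 a2 t2,
         ts_from T1 a1 s1, ts_from T2 a2 s2 &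
         (a1 <= s1 <= t1) && (a2 <= s2 <= t2)]].

(* Main.v *)
Require Import Defs.
From HB Require Import structures.
From mathcomp Require Import all_boot all_order all_algebra.
From mathcomp Require Import all_classical all_reals all_analysis.
From mathcomp Require Import ring lra.

Set Implicit Arguments.
Unset Strict Implicit.
Unset Printing Implicit Defensive.

Import Order.TTheory GRing.Theory Num.Theory.
Import numFieldNormedType.Exports.

Local Open Scope classical_set_scope.
Local Open Scope ring_scope.

(** Fix the endpoint (t1, t2) and freeze the kernel there.  Since a and f are
nondecreasing in t1 and t2 and all the integrands are nonnegative, the
hypothesis at (s, x), for s <= t1 and x <= t2, gives u s x <= Z s, where
  Z s = a t1 t2 + int_{a1}^s int_{a2}^{t2} f t1 t2 s1 s2 * u s1 s2.
The bound does not depend on x, so inserting it under the inner integral of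
Z^Delta yields Z^Delta <= p Z with Z a1 = a t1 t2.  Comparison with the solution
a t1 t2 * e_p of the corresponding equation gives Z t1 <= a t1 t2 * e_p(t1, a1),
and u t1 t2 <= Z t1.

The integral and the exponential are given by an arbitrary primitive, resp.
solution, when there is one, so the argument rests on existence and uniqueness
for y^Delta = p y + q on a compact piece of a time scale.

Uniqueness, monotonicity of the integral and the final comparison all come from
[delta_primitive_le]: if (F - G)^Delta <= p (F - G) with p bounded and
nonnegative and F <= G initially, then F <= G.  It follows from
[delta_gronwall_exp], a bound by a real exponential proved by induction along
the time scale.

Existence ([linear_delta_eq_exists]) is proved by Perron's method: for continuous
p, q >= 0 the pointwise supremum of the subsolutions is a solution.  The case
p = 0 provides integrals and the case q = 0 provides the exponential.  Finally p
and Z^Delta are integrals depending on a parameter; they are continuous by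
compactness of the domain of integration ([delta_int_continuous]), which makes
the existence theorem applicable to them. *)

(** * Continuity on subsets *)

Lemma within_continuous_leP (R : realType) (T : topologicalType) (A : set T)
    (f : T -> R) :
  {within A, continuous f} <->
  forall x, A x -> forall e, 0 < e ->
    \forall y \near x, A y -> `|f x - f y| <= e.
Proof.
split=> [/subspace_continuousP cf x Ax e e0|cf].
  have /cvgrPdist_le /(_ e e0) := cf x Ax.
  by rewrite near_withinE.
apply/subspace_continuousP => x Ax; apply/cvgrPdist_le => e e0.
by rewrite near_withinE; exact: cf.
Qed.

Lemma within_continuous_comp_sub (U V W : topologicalType) (A : set V)
    (B : set U) (f : V -> U) (g : U -> W) :
  continuous f -> (forall x, A x -> B (f x)) -> {within B, continuous g} ->
  {within A, continuous (g \o f)}.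
Proof.
move=> fc fAB /subspace_continuousP gc; apply/subspace_continuousP => x Ax.
apply: cvg_trans (gc _ (fAB x Ax)) => P; rewrite /= !nbhs_simpl /within /= => HP.
have := fc x _ HP; rewrite nbhs_simpl /=; apply: filterS => y + Ay; apply.
exact: fAB.
Qed.

Lemma within_continuous_slice (U V W : topologicalType) (A : set U) (B : set V)
    (k : U -> V -> W) (s : U) :
  {within A `*` B, continuous (fun z : U * V => k z.1 z.2)} -> A s ->
  {within B, continuous (k s)}.
Proof.
move=> kc As.
apply: (within_continuous_comp_sub (f := fun x => (s, x)) _ _ kc) => // x.
by apply: cvg_pair; [exact: cvg_cst|exact: cvg_id].
Qed.

Lemma compact_within_bounded (R : realType) (K : set R) (g : R -> R) :
  compact K -> {within K, continuous g} ->
  exists M, forall x, K x -> `|g x| <= M.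
Proof.
move=> cK cg; have /compact_bounded [M [_ HM]] := continuous_compact cg cK.
by exists (M + 1) => x Kx; apply: (HM (M + 1)); [rewrite ltrDl|exists x].
Qed.

(** * Intervals of a time scale and the forward jump *)

Lemma ts_seg_closed (R : realType) (T : set R) (c d : R) :
  closed T -> closed (ts_seg T c d).
Proof. by move=> Tc; apply: closedI => //; exact: interval_closed. Qed.

Lemma ts_seg_compact (R : realType) (T : set R) (c d : R) :
  closed T -> compact (ts_seg T c d).
Proof.
move=> Tc; apply: (subclosed_compact _ (segment_compact (a:=c) (b:=d))).
  exact: ts_seg_closed.
by move=> x [].
Qed.

Lemma ts_segP (R : realType) (T : set R) (c d x : R) :
  ts_seg T c d x <-> [/\ T x, c <= x & x <= d].
Proof.
by rewrite /ts_seg /= in_itv /=; split=> [[Tx /andP[]]|[Tx -> ->]].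
Qed.

Section sigma.
Variables (R : realType) (K : set R) (t d : R).
Hypotheses (Kc : closed K) (Kd : K d) (td : t < d).

Let above := [set s | K s /\ t < s].

Let above_has_inf : has_inf above.
Proof. by split; [exists d | exists t => s [_ /ltW]]. Qed.

Lemma sigma_inf : sigma K t = inf above.
Proof.
by rewrite /sigma /=; case: asboolP => // -[]; exists d.
Qed.

Lemma sigma_ge : t <= sigma K t.
Proof.
by rewrite sigma_inf; apply: lb_le_inf => [|s [_ /ltW]//]; exists d.
Qed.

Lemma sigma_le s : K s -> t < s -> sigma K t <= s.
Proof.
move=> Ks ts; rewrite sigma_inf; apply: ge_inf => //.
by exists t => s' [_ /ltW].
Qed.

Lemma sigma_adherent e : 0 < e ->
  exists s, [/\ K s, t < s & s < sigma K t + e].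
Proof.
move=> e0; have [s [Ks ts] se] := inf_adherent e0 above_has_inf.
by exists s; rewrite sigma_inf.
Qed.

Lemma sigma_mem : K (sigma K t).
Proof.
apply: Kc => B /nbhs_ballP[e /= e0 eB].
have [s [Ks ts se]] := sigma_adherent e0.
exists s; split=> //; apply: eB; rewrite /ball /=.
rewrite distrC ger0_norm ?subr_ge0 ?sigma_le//; lra.
Qed.
End sigma.

(** Cutting an interval at a point e of the time scale does not change the
forward jump to the left of e: a point of [c, d] beyond t is either at most e, or
larger than e, which is itself beyond t. *)
Lemma sigma_ts_seg (R : realType) (T : set R) (c d e t : R) :
  T e -> c <= e -> e <= d -> t < e ->
  sigma (ts_seg T c e) t = sigma (ts_seg T c d) t.
Proof.
move=> Te ce ed te.
have Kee : ts_seg T c e e by apply/ts_segP.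
have Kde : ts_seg T c d e by apply/ts_segP.
rewrite (sigma_inf Kee te) (sigma_inf Kde te).
apply/eqP; rewrite eq_le; apply/andP; split.
  apply: lb_le_inf; first by exists e.
  move=> s [/ts_segP[Ts cs sd] ts].
  have [se|/ltW es] := leP s e.
    by apply: ge_inf; [exists t => ? [_ /ltW]|split=> //; apply/ts_segP].
  apply: le_trans es; apply: ge_inf; first by exists t => ? [_ /ltW].
  by split.
apply: lb_le_inf; first by exists e.
move=> s [/ts_segP[Ts cs sd] ts].
apply: ge_inf; first by exists t => ? [_ /ltW].
by split=> //; apply/ts_segP; split=> //; exact: le_trans ed.
Qed.

(** * Induction on a time scale and the Gronwall bound *)

Section gronwall.
Variables (R : realType) (T : set R) (c d : R).
Hypotheses (Tc : closed T) (Tc0 : T c) (Td : T d) (cd : c <= d).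
Let K := ts_seg T c d.

Let Kc : K c. Proof. by apply/ts_segP. Qed.
Let Kd : K d. Proof. by apply/ts_segP. Qed.

(** Induction along a compact piece of a time scale, where points may be isolated
or not on either side.  The property must pass to limits from the left, be
transmitted across a gap, and spread to the right of a point that is not followed
by a gap.  Then the supremum of the points up to which it holds can only be d. *)
Lemma ts_seg_induction (P : R -> Prop) :
  P c ->
  (forall m, K m -> (forall e, 0 < e -> exists s, [/\ K s, m - e < s, s <= m & P s]) -> P m) ->
  (forall m, K m -> m < d -> P m ->
     let x := sigma K m in
     P x /\ (x = m -> exists2 e, 0 < e & forall s, K s -> m < s -> s < m + e -> P s)) ->
  forall t, K t -> P t.
Proof.
move=> Pc Pl Pr.
pose S := [set t | K t /\ forall s, K s -> s <= t -> P s].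
have Sc : S c.
  split=> // s /ts_segP[_ cs _] sc.
  by have -> : s = c by apply/eqP; rewrite eq_le cs sc.
have Sub : ubound S d by move=> x [/ts_segP[]].
have hS : has_sup S by split; [exists c | exists d].
pose m := sup S.
have Km : K m.
  apply: (ts_seg_closed (c:=c) (d:=d) Tc).
  apply: (@closureS _ S); first by move=> x [].
  by apply: closure_sup; [exists c|exists d].
have Slt s : K s -> s < m -> P s.
  move=> Ks sm; have ms0 : 0 < m - s by rewrite subr_gt0.
  have [t [Kt Pt] mt] := sup_adherent ms0 hS.
  by apply: Pt => //; move: mt; rewrite -/m; lra.
have Pm : P m.
  apply: Pl => // e e0; have [t [Kt Pt] mt] := sup_adherent e0 hS.
  by exists t; split=> //; [apply: ub_le_sup; [exists d|]|exact: Pt].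
have Sle s : K s -> s <= m -> P s.
  by move=> Ks; rewrite le_eqVlt => /predU1P[->//|]; exact: Slt.
have Smax s : K s -> (forall s', K s' -> m < s' -> s' <= s -> P s') -> s <= m.
  move=> Ks Ps; apply: ub_le_sup; first by exists d.
  by split=> // s' Ks' s's; have [/(Sle _ Ks')//|/Ps] := leP s' m; exact.
(* If m < d, then the property would hold beyond m: up to the next point when
   there is a gap after m, and on a right neighbourhood of m otherwise. *)
suff dm : d = m.
  by move=> t Kt; apply: Sle => //; rewrite -dm; case/ts_segP: Kt.
apply/eqP; rewrite eq_le; case/ts_segP: (Km) => _ _ ->.
rewrite andbT leNgt; apply/negP => md.
have [Px Pn] := Pr m Km md Pm.
set x := sigma K m in Px Pn.
have Kcl : closed K by exact: ts_seg_closed.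
have mx : m <= x := sigma_ge Kd md.
have xm : x = m.
  apply/eqP; rewrite eq_le mx andbT; apply: Smax.
    exact: (sigma_mem Kcl Kd md).
  move=> s Ks ms sx; have xs : x <= s := sigma_le Kd md Ks ms.
  by have -> : s = x by apply/eqP; rewrite eq_le sx xs.
have [e e0 He] := Pn xm.
have [s [Ks ms se]] := sigma_adherent Kd md e0.
have : s <= m.
  apply: Smax => // s' Ks' ms' s's; apply: He => //.
  by rewrite -xm; exact: le_lt_trans s's se.
by rewrite leNgt ms.
Qed.

(** The real exponential E t = B * exp ((M + 1) (t - c)) grows faster than w: over
a step of length h from m, w grows at most by (l m + E m) h, where the term E m
absorbs the error in the definition of the derivative, and
E m * (1 + (M + 1) h) <= E (m + h) by convexity.  The same estimate serves for a
gap, where h is its length, and for the points close to a right-dense m. *)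
Lemma delta_gronwall_exp (w l p : R -> R) (M B : R) :
  delta_primitive T c d l w -> 0 < B -> w c <= B ->
  (forall t, K t -> t < d -> 0 <= p t <= M /\ l t <= p t * w t) ->
  forall t, K t -> w t <= B * expR ((M + 1) * (t - c)).
Proof.
move=> [wc wd] B0 wcB lp.
pose E t := B * expR ((M + 1) * (t - c)).
have E0 t : 0 < E t by rewrite mulr_gt0 ?expR_gt0.
have step m s : K m -> m < d -> w m <= E m -> m <= s ->
    w s <= w m + (l m + E m) * (s - m) -> w s <= E s.
  move=> Km md wm ms; move/le_trans; apply.
  (* As 0 <= p <= M and w m <= E m, we have l m <= p m * w m <= M * E m. *)
  have [/andP[p0 pM] lpm] := lp m Km md.
  have -> : E s = E m * expR ((M + 1) * (s - m)).
    by rewrite /E -mulrA -expRD; congr (_ * expR _); ring.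
  apply: (@le_trans _ _ (E m * (1 + (M + 1) * (s - m)))); last first.
    by rewrite ler_pM2l// expR_ge1Dx.
  have lE : l m + E m <= E m * (M + 1).
    have : p m * w m <= p m * E m by apply: ler_wpM2l.
    have : p m * E m <= M * E m by apply: ler_wpM2r => //; exact: ltW.
    lra.
  have sm : 0 <= s - m by rewrite subr_ge0.
  have := ler_wpM2r sm lE.
  lra.
apply: ts_seg_induction.
- by rewrite subrr mulr0 expR0 mulr1.
- move=> m Km Hm; rewrite leNgt; apply/negP => wm.
  have cE : {within K, continuous (fun t => w t - E t)}.
    apply/subspace_continuousP => x Kx; apply: cvgB.
      by move/subspace_continuousP: wc; exact.
    apply: cvg_within_filter; apply: cvgM; first exact: cvg_cst.
    apply: continuous_cvg; first exact: continuous_expR.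
    apply: cvgM; first exact: cvg_cst.
    by apply: cvgB => //; exact: cvg_cst.
  have g0 : 0 < (w m - E m) / 2 by rewrite divr_gt0// subr_gt0.
  have /within_continuous_leP /(_ m Km _ g0) := cE.
  move/nbhs_ballP => [e /= e0 He].
  have [s [Ks mes sm ws]] := Hm e e0.
  have /He /(_ Ks) : ball m e s.
    by rewrite /ball /= ger0_norm ?subr_ge0//; lra.
  have := ler_norm (w m - E m - (w s - E s)).
  by move: ws; rewrite -/(E s) => ? ? ?; rewrite -/(E m) in wm g0 *; lra.
- move=> m Km md wm x.
  have mx : m <= x := sigma_ge Kd md.
  have [Tm cm _] := (ts_segP _ _ _ _).1 Km.
  have := wd m Tm cm md (E m) (E0 m).
  rewrite -/K -/x => /nbhs_ballP[e /= e0 He]; split.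
    apply: (step m) => //.
    have /He /(_ Km) := ballxx m e0.
    rewrite (ger0_norm (_ : 0 <= x - m)) ?subr_ge0//.
    have := ler_norm (w x - w m - l m * (x - m)); lra.
  move=> xm; exists e => // s Ks ms se.
  apply: (step m) => //; first exact: ltW.
  have /He /(_ Ks) : ball m e s.
    by rewrite /ball /= distrC ger0_norm; lra.
  have ms0 : m - s <= 0 by lra.
  rewrite xm (ler0_norm ms0).
  have := ler_norm (- (w m - w s - l m * (m - s))); rewrite normrN; lra.
Qed.

End gronwall.

(** * Primitives and their comparison *)

Section primitives.
Variables (R : realType) (T : set R) (c d : R).
Hypotheses (Tc : closed T) (Tc0 : T c) (Td : T d) (cd : c <= d).
Let K := ts_seg T c d.

Let Kc : K c. Proof. by apply/ts_segP. Qed.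
Let Kd : K d. Proof. by apply/ts_segP. Qed.

Lemma is_delta_deriv_lin (A : set R) (F G : R -> R) (t k l x y : R) :
  is_delta_deriv A F t k -> is_delta_deriv A G t l ->
  is_delta_deriv A (fun s => x * F s + y * G s) t (x * k + y * l).
Proof.
move=> hF hG e e0.
have xy0 : 0 < `|x| + `|y| + 1.
  by rewrite ltr_wpDl// addr_ge0.
have e'0 : 0 < e / (`|x| + `|y| + 1) by rewrite divr_gt0.
apply: filterS2 (hF _ e'0) (hG _ e'0) => s hFs hGs As.
move/(_ As) : hFs => h1; move/(_ As) : hGs => h2.
set r := sigma A t.
have -> : x * F r + y * G r - (x * F s + y * G s) - (x * k + y * l) * (r - s)
  = x * (F r - F s - k * (r - s)) + y * (G r - G s - l * (r - s)) by ring.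
apply: le_trans (ler_normD _ _) _; rewrite !normrM.
apply: le_trans (lerD (ler_wpM2l (normr_ge0 x) h1)
                      (ler_wpM2l (normr_ge0 y) h2)) _.
set e' := e / _ in e'0 *; set N := `|r - s|.
have -> : e * N = e' * (`|x| + `|y| + 1) * N by rewrite divfK// gt_eqF.
have : 0 <= e' * N by apply: mulr_ge0; [exact: ltW|exact: normr_ge0].
lra.
Qed.

Lemma delta_primitive_lin (g h F G : R -> R) (x y : R) :
  delta_primitive T c d g F -> delta_primitive T c d h G ->
  delta_primitive T c d (fun s => x * g s + y * h s)
                        (fun s => x * F s + y * G s).
Proof.
move=> [Fc Fd] [Gc Gd]; split.
  apply/subspace_continuousP => s Ks.
  move/subspace_continuousP : Fc => /(_ s Ks) Fs.
  move/subspace_continuousP : Gc => /(_ s Ks) Gs.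
  by apply: cvgD; (apply: cvgM; first exact: cvg_cst).
by move=> t Tt ct td; apply: is_delta_deriv_lin; [exact: Fd|exact: Gd].
Qed.

Lemma delta_primitive_id : delta_primitive T c d (fun=> 1) id.
Proof.
split; first by apply: continuous_subspaceT => x; exact: cvg_id.
move=> t Tt ct td e e0; apply: filterE => s _.
by rewrite mul1r subrr normr0 mulr_ge0// ltW.
Qed.

Lemma delta_primitive_cst k : delta_primitive T c d (fun=> 0) (fun=> k).
Proof.
split; first by apply: continuous_subspaceT => x; exact: cvg_cst.
move=> t Tt ct td e e0; apply: filterE => s _.
by rewrite mul0r !subrr normr0 mulr_ge0// ltW.
Qed.

Lemma eq_delta_primitive (g h F : R -> R) :
  (forall t, K t -> t < d -> g t = h t) ->
  delta_primitive T c d g F -> delta_primitive T c d h F.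
Proof.
move=> gh [Fc Fd]; split=> // t Tt ct td; rewrite -gh//; first exact: Fd.
by apply/ts_segP; split=> //; exact: ltW.
Qed.

(** [delta_gronwall_exp] applies to F - G with every B > 0, so F - G is below every
positive multiple of an exponential.  With p = 0 this compares primitives; with
g = p * F and h = p * G it compares solutions of the same linear equation. *)
Lemma delta_primitive_le (p g h F G : R -> R) (M : R) :
  delta_primitive T c d g F -> delta_primitive T c d h G -> F c <= G c ->
  (forall t, K t -> t < d ->
     0 <= p t <= M /\ g t - h t <= p t * (F t - G t)) ->
  forall t, K t -> F t <= G t.
Proof.
move=> Fg Gh FGc gh t Kt.
have FG := delta_primitive_lin 1 (-1) Fg Gh.
rewrite -subr_le0 leNgt; apply/negP => FGt.
have E0 := expR_gt0 ((M + 1) * (t - c)).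
(* This constant makes the bound at t equal to half of F t - G t, which would
   then be at most its own half. *)
have B0 : 0 < (F t - G t) / 2 / expR ((M + 1) * (t - c)).
  by rewrite !divr_gt0.
have := delta_gronwall_exp (p := p) (M := M) Tc Tc0 Td cd FG B0 _ _ Kt.
rewrite divfK ?gt_eqF// => H.
suff : 1 * F t + -1 * G t <= (F t - G t) / 2 by lra.
apply: H => [|s Ks sd]; first by apply: le_trans (ltW B0); lra.
by have [? ?] := gh s Ks sd; split=> //; lra.
Qed.

Lemma delta_primitive_restrict (e : R) (g F : R -> R) :
  T e -> c <= e -> e <= d ->
  delta_primitive T c d g F -> delta_primitive T c e g F.
Proof.
move=> Te ce ed [Fc Fd].
have sub : ts_seg T c e `<=` ts_seg T c d.
  move=> x /ts_segP[Tx cx xe]; apply/ts_segP; split=> //; exact: le_trans ed.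
split; first exact: continuous_subspaceW Fc.
move=> t Tt ct te eps eps0; rewrite (sigma_ts_seg Te ce ed te).
have := Fd t Tt ct (lt_le_trans te ed) eps eps0.
by apply: filterS => s H /sub.
Qed.

(** * Existence for the linear equation, by Perron's method *)

Section existence.
Variables (p q : R -> R) (y0 : R).
Hypotheses (pc : {within K, continuous p}) (qc : {within K, continuous q}).
Hypotheses (p0 : forall t, K t -> 0 <= p t) (q0 : forall t, K t -> 0 <= q t).
Hypothesis y00 : 0 <= y0.

Section perron.
Variable M : R.
Hypothesis pqM : forall t, K t -> p t + q t <= M.

Let M0 : 0 <= M.
Proof. by apply: le_trans (pqM Kc); rewrite addr_ge0 ?p0 ?q0. Qed.

(* A supersolution that dominates the subsolutions, so that their supremum is
   finite. *)
Let E x := (y0 + 1) * expR (M * (x - c)).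

Let E_step s t : s <= t -> E s * (1 + M * (t - s)) <= E t.
Proof.
move=> st; have -> : E t = E s * expR (M * (t - s)).
  by rewrite /E -mulrA -expRD; congr (_ * expR _); ring.
by rewrite ler_wpM2l ?expR_ge1Dx// mulr_ge0 ?expR_ge0// addr_ge0.
Qed.

Let E_ge t : K t -> y0 + 1 <= E t.
Proof.
move=> /ts_segP[_ ct _]; rewrite ler_peMr ?addr_ge0//.
apply: le_trans (expR_ge1Dx _); rewrite lerDl mulr_ge0// subr_ge0//.
Qed.

Let E_nd s t : K s -> s <= t -> E s <= E t.
Proof.
move=> Ks st; apply: le_trans (E_step st); rewrite ler_peMr//.
  by apply: le_trans (E_ge Ks); rewrite addr_ge0.
by rewrite lerDl mulr_ge0// subr_ge0.
Qed.

Let rhs_le x y : K x -> y <= E x -> p x * y + q x <= M * E x.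
Proof.
move=> Kx yE; have E1 : 1 <= E x by apply: le_trans (E_ge Kx); rewrite lerDr.
have h1 := ler_wpM2l (p0 Kx) yE.
have h2 := ler_wpM2l (q0 Kx) E1.
have h3 : (p x + q x) * E x <= M * E x.
  by apply: ler_wpM2r (pqM Kx); apply: le_trans E1.
by rewrite mulr1 in h2; lra.
Qed.

(** The inequality v^Delta <= p v + q in integrated form, which makes sense
for v without a derivative and so passes to suprema: p >= 0 makes the right-hand
side monotone in v. *)
Definition subsolution (v : R -> R) : Prop :=
  [/\ v c <= y0, forall x, K x -> v x <= E x &
      forall s t N, K s -> K t -> s < t ->
        (forall x, K x -> s <= x -> x < t -> p x * v x + q x <= N) ->
        v t - v s <= N * (t - s)].

Definition perron (t : R) : R := sup [set v t | v in subsolution].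

Let F := perron.

Let sub_cst : subsolution (fun=> y0).
Proof.
split=> // [x Kx|s t N Ks Kt st /(_ s Ks (lexx _) st) sN].
  by have := E_ge Kx; lra.
have ts0 : 0 <= t - s by lra.
rewrite subrr mulr_ge0//.
apply: le_trans sN; rewrite addr_ge0 ?q0// mulr_ge0// p0//.
Qed.

Let F_ub v t : K t -> subsolution v -> v t <= F t.
Proof.
move=> Kt sv; apply: ub_le_sup; last by exists v.
by exists (E t) => _ [w [_ wE _] <-]; exact: wE.
Qed.

Let F_le t B : (forall v, subsolution v -> v t <= B) -> F t <= B.
Proof.
move=> vB; apply: ge_sup; first by exists y0, (fun=> y0).
by move=> _ [w sw <-]; exact: vB.
Qed.

Lemma perron_subsolution : subsolution F.
Proof.
split=> [|x Kx|s t N Ks Kt st FN]; first by apply: F_le => v [].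
  by apply: F_le => v [_ + _]; exact.
rewrite lerBlDr; apply: F_le => v sv; have [_ _ vinc] := sv.
have h : v t - v s <= N * (t - s).
  apply: vinc => // x Kx sx xt; apply: le_trans (FN x Kx sx xt).
  by rewrite lerD2r ler_wpM2l ?p0// F_ub.
have := F_ub Ks sv; lra.
Qed.

Lemma perron_init : F c = y0.
Proof.
apply/eqP; rewrite eq_le; apply/andP; split; first by apply: F_le => v [].
exact: (F_ub Kc sub_cst).
Qed.

Let F_ge0 t : K t -> 0 <= F t.
Proof. by move=> Kt; apply: le_trans (F_ub Kt sub_cst). Qed.

(** Maximality of the supremum F.  Let F be continued after s by the straight line
of slope n until t, and by a constant beyond.  As long as n is at most the
right-hand side evaluated at F s, this is again a subsolution, because the
right-hand side is monotone in the unknown, and nonnegative where the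
continuation is constant; hence it stays below F at t. *)
Lemma perron_lower s t n : K s -> K t -> s < t -> 0 <= n ->
  (forall x, K x -> s <= x -> x < t -> n <= p x * F s + q x) ->
  n * (t - s) <= F t - F s.
Proof.
move=> Ks Kt st n0 nF.
have [Fc FE Finc] := perron_subsolution.
pose v x := if x <= s then F x else F s + n * (Num.min x t - s).
have vs x : x <= s -> v x = F x by rewrite /v => ->.
have vt x : s < x -> v x = F s + n * (Num.min x t - s).
  by rewrite /v ltNge => /negbTE ->.
suff sv : subsolution v.
  by have := F_ub Kt sv; rewrite vt// minxx; lra.
have v_ge x : s < x -> F s <= v x.
  move=> sx; rewrite vt// lerDl mulr_ge0// subr_ge0 le_min.
  by rewrite !ltW.
have vinc x y : s <= x -> x < y -> v y - v x <= n * (Num.min y t - Num.min x t).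
  move=> sx xy; have sy := le_lt_trans sx xy.
  move: sx; rewrite le_eqVlt => /predU1P[sx|sx].
    subst x; rewrite vt// vs// (min_idPl (ltW st)); lra.
  by rewrite !vt//; lra.
(* For the increments over [s1, t1]: if [s1, t1) meets [s, t), then a point where
   they meet shows n <= N; if s1 >= t, then v is constant and 0 <= N. *)
split=> [|x Kx|s1 t1 N Ks1 Kt1 st1 vN].
- by rewrite vs//; case/ts_segP: Ks.
- have [xs|sx] := leP x s; first by rewrite vs//; exact: FE.
  rewrite vt//; apply: le_trans (E_step (ltW sx)).
  have nM : n <= M * E s.
    by apply: le_trans (nF s Ks (lexx _) st) _; apply: rhs_le => //; exact: FE.
  have h1 : n * (Num.min x t - s) <= n * (x - s).
    by rewrite ler_wpM2l// lerD2r ge_min lexx.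
  have h2 : n * (x - s) <= M * E s * (x - s).
    by rewrite ler_wpM2r// subr_ge0 ltW.
  have := FE s Ks; lra.
- have [t1s|st1'] := leP t1 s.
    rewrite !vs//; last exact: ltW (lt_le_trans st1 t1s).
    apply: Finc => // x Kx s1x xt1; rewrite -vs; first exact: vN.
    exact: ltW (lt_le_trans xt1 t1s).
  have [s1s|ss1] := leP s1 s.
    have nN : n <= N.
      apply: le_trans (nF s Ks (lexx _) st) _.
      by rewrite -{1}(vs s)//; exact: vN.
    have h1 : v t1 - v s <= n * (t1 - s).
      apply: le_trans (vinc s t1 (lexx _) st1') _.
      by rewrite (min_idPl (ltW st)) ler_wpM2l// lerD2r ge_min lexx.
    have h2 : n * (t1 - s) <= N * (t1 - s).
      by rewrite ler_wpM2r// subr_ge0 ltW.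
    suff : v s - v s1 <= N * (s - s1) by lra.
    move: s1s; rewrite le_eqVlt => /predU1P[->|s1s]; first by rewrite !subrr mulr0.
    rewrite (vs s)// (vs s1 (ltW s1s)); apply: Finc => // x Kx s1x xs.
    by rewrite -(vs x (ltW xs)); apply: vN => //; exact: lt_trans st1'.
  have vs1 := vN s1 Ks1 (lexx _) st1.
  have Fv : p s1 * F s + q s1 <= p s1 * v s1 + q s1.
    by rewrite lerD2r ler_wpM2l ?p0 ?v_ge.
  have N0 : 0 <= N.
    apply: le_trans vs1; apply: le_trans Fv.
    by rewrite addr_ge0 ?q0 ?mulr_ge0 ?p0 ?F_ge0.
  apply: le_trans (vinc s1 t1 (ltW ss1) st1) _.
  have [ts1|s1t] := leP t s1.
    rewrite (min_idPr (ltW (le_lt_trans ts1 st1))) subrr mulr0.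
    by rewrite mulr_ge0// subr_ge0 ltW.
  have nN : n <= N.
    by apply: le_trans vs1; apply: le_trans Fv; apply: nF => //; exact: ltW.
  apply: (@le_trans _ _ (n * (t1 - s1))).
    by rewrite ler_wpM2l// lerD2r ge_min lexx.
  by rewrite ler_wpM2r// subr_ge0 ltW.
Qed.

(* A bound of the right-hand side at F, hence a Lipschitz constant of F. *)
Let L := M * E d.

Let L0 : 0 <= L.
Proof.
rewrite mulr_ge0//; apply: le_trans (E_ge Kd); by rewrite addr_ge0.
Qed.

Lemma perron_nondecreasing s t : K s -> K t -> s <= t -> F s <= F t.
Proof.
move=> Ks Kt; rewrite le_eqVlt => /predU1P[->//|st].
rewrite -subr_ge0 -(mul0r (t - s)); apply: perron_lower => // x Kx _ _.
by rewrite addr_ge0 ?q0 ?mulr_ge0 ?p0 ?F_ge0.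
Qed.

Let F_lip1 s t : K s -> K t -> s <= t -> F t - F s <= L * (t - s).
Proof.
have [Fc FE Finc] := perron_subsolution.
move=> Ks Kt; rewrite le_eqVlt => /predU1P[->|st]; first by rewrite !subrr mulr0.
apply: Finc => // x Kx _ _; apply: le_trans (rhs_le Kx (FE x Kx)) _.
by rewrite ler_wpM2l// E_nd//; case/ts_segP: Kx.
Qed.

Let F_lip s t : K s -> K t -> `|F t - F s| <= L * `|t - s|.
Proof.
move=> Ks Kt; have [st|/ltW ts] := leP s t.
  by rewrite !ger0_norm ?subr_ge0 ?perron_nondecreasing ?F_lip1.
by rewrite distrC (distrC t) !ger0_norm ?subr_ge0 ?perron_nondecreasing ?F_lip1.
Qed.

Let F_cont : {within K, continuous F}.
Proof.
apply/within_continuous_leP => x Kx e e0.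
have L1 : 0 < L + 1 by rewrite ltr_wpDl.
apply/nbhs_ballP; exists (e / (L + 1)) => [|y]; first exact: divr_gt0.
rewrite /ball /= ltr_pdivlMr// => xy Ky; apply: le_trans (F_lip Ky Kx) _.
have : 0 <= `|x - y| by []. lra.
Qed.

Let rhs_cont : {within K, continuous (fun t => p t * F t + q t)}.
Proof.
move/subspace_continuousP : F_cont => Fc; apply/subspace_continuousP => x Kx.
apply: cvgD; last by move/subspace_continuousP: qc; exact.
by apply: cvgM; [move/subspace_continuousP: pc; exact|exact: Fc].
Qed.

(** The subsolution inequality bounds the increments of F from above and
[perron_lower] bounds them from below.  Across a gap both bounds equal the
right-hand side times the length of the gap; on short
intervals near a right-dense point, they differ from that product by a small
fraction of the length, by continuity. *)
Lemma perron_primitive :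
  delta_primitive T c d (fun t => p t * F t + q t) F.
Proof.
have [Fc FE Finc] := perron_subsolution.
split=> // t Tt ct td.
have Kt : K t by apply/ts_segP; split=> //; exact: ltW.
have KC : closed K by exact: ts_seg_closed.
set k := p t * F t + q t => e e0; rewrite -/K.
have k0 : 0 <= k by rewrite /k addr_ge0 ?q0 ?mulr_ge0 ?p0 ?F_ge0.
have := sigma_ge Kd td; rewrite le_eqVlt => /predU1P[ts|ts].
  rewrite -ts.
  have e2 : 0 < e / 2 by rewrite divr_gt0.
  have /within_continuous_leP /(_ t Kt _ e2) := rhs_cont.
  move=> /nbhs_ballP[r /= r0 Hr].
  (* [perron_lower] has the right-hand side at F s1 instead of F x.  The
     difference p x * (F x - F s1) is at most M * L * r', and r' makes that
     smaller than e / 2. *)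
  have ML1 : 0 < M * L + 1 by rewrite ltr_wpDl// mulr_ge0.
  pose r' := Num.min r (e / 2 / (M * L + 1)).
  have r'0 : 0 < r' by rewrite lt_min r0 divr_gt0.
  have Hk x : K x -> `|t - x| < r' -> `|k - (p x * F x + q x)| <= e / 2.
    move=> Kx; rewrite lt_min => /andP[tx _].
    by apply: Hr.
  have main s1 s2 : K s1 -> K s2 -> s1 < s2 -> `|s2 - s1| < r' ->
      (forall x, s1 <= x -> x < s2 -> `|t - x| < r') ->
      `|F s2 - F s1 - k * (s2 - s1)| <= e * (s2 - s1).
    move=> Ks1 Ks2 s12 s12r near_t.
    have up : F s2 - F s1 <= (k + e / 2) * (s2 - s1).
      apply: Finc => // x Kx s1x xs2.
      have := Hk x Kx (near_t x s1x xs2).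
      by rewrite ler_norml => /andP[]; rewrite -/F; lra.
    have lo : (k - e) * (s2 - s1) <= F s2 - F s1.
      (* [perron_lower] needs a nonnegative slope; if k - e is not, then the
         bound follows from monotonicity of F. *)
      have [ke|ke] := leP (k - e) 0.
        have : 0 <= F s2 - F s1 by rewrite subr_ge0 perron_nondecreasing// ltW.
        apply: le_trans; rewrite mulr_le0_ge0// subr_ge0 ltW//.
      apply: perron_lower => //; first exact: ltW.
      move=> x Kx s1x xs2.
      have := Hk x Kx (near_t x s1x xs2).
      rewrite ler_norml => /andP[_ h1].
      have h2 : p x * (F x - F s1) <= e / 2.
        apply: (@le_trans _ _ (M * (L * r'))).
          apply: ler_pM; rewrite ?p0// ?subr_ge0 ?perron_nondecreasing//.
            by apply: le_trans (pqM Kx); rewrite lerDl q0.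
          apply: le_trans (F_lip1 Ks1 Kx s1x) _; rewrite ler_wpM2l//.
          move: s12r; rewrite ger0_norm; lra.
        have : r' <= e / 2 / (M * L + 1) by rewrite ge_min lexx orbT.
        rewrite ler_pdivlMr//; move: r'0; rewrite -/r'; nra.
      move: h1 h2; rewrite -/F; lra.
    rewrite ler_norml; apply/andP; split; first by lra.
    have : 0 <= e / 2 * (s2 - s1) by rewrite mulr_ge0 ?subr_ge0// ltW.
    lra.
  apply/nbhs_ballP; exists r' => // s; rewrite /ball /= => tsr Ks.
  have [st|ts'|->] := ltgtP s t.
  - rewrite (ger0_norm (_ : 0 <= t - s)) ?subr_ge0; last exact: ltW.
    apply: main => // x sx xt.
    apply: le_lt_trans tsr; rewrite !ger0_norm; lra.
  - have -> : F t - F s - k * (t - s) = - (F s - F t - k * (s - t)) by ring.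
    rewrite normrN (distrC t s) (ger0_norm (_ : 0 <= s - t)) ?subr_ge0; last exact: ltW.
    apply: main => //; first by rewrite distrC.
    move=> x tx xs.
    apply: le_lt_trans tsr; rewrite !ler0_norm; lra.
  - by rewrite !subrr mulr0 subrr normr0 mulr0.
(* Otherwise t is followed by a gap, from t to x: the points s of K close to t
   are at most t, and |x - s| is at least the length of the gap, so that
   continuity of F at t suffices. *)
set x := sigma K t in ts *.
have Kx : K x := sigma_mem KC Kd td.
have only y : K y -> t <= y -> y < x -> y = t.
  move=> Ky; rewrite le_eqVlt => /predU1P[->//|ty].
  by rewrite ltNge (sigma_le Kd td Ky ty).
have Fx : F x - F t = k * (x - t).
  apply/eqP; rewrite eq_le; apply/andP; split.
    by apply: Finc => // y Ky ty yx; rewrite (only y).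
  by apply: perron_lower => // y Ky ty yx; rewrite (only y).
have Lk : 0 < L + k + 1 by rewrite ltr_wpDl// addr_ge0.
have xt0 : 0 < x - t by rewrite subr_gt0.
apply/nbhs_ballP; exists (Num.min (x - t) (e * (x - t) / (L + k + 1))) => /=.
  by rewrite lt_min xt0 divr_gt0// mulr_gt0.
move=> s; rewrite /ball /= lt_min ltr_pdivlMr// => /andP[tsx tse] Ks.
have st : s <= t.
  rewrite leNgt; apply/negP => ts'.
  have : x <= s by exact: (sigma_le Kd td).
  move: tsx; rewrite distrC ger0_norm; lra.
have -> : F x - F s - k * (x - s) = (F t - F s) - k * (t - s).
  have -> : F x - F s = F x - F t + (F t - F s) by ring.
  by rewrite Fx; ring.
apply: le_trans (ler_normB _ _) _; rewrite normrM (ger0_norm k0).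
have h1 := F_lip Ks Kt.
have h2 : e * (x - t) <= e * `|x - s|.
  rewrite ler_pM2l// ger0_norm; lra.
have : 0 <= `|t - s| by []. lra.
Qed.

End perron.

Lemma linear_delta_eq_exists : exists F,
  [/\ delta_primitive T c d (fun t => p t * F t + q t) F, F c = y0 &
      forall s t, K s -> K t -> s <= t -> F s <= F t].
Proof.
have cK : compact K by exact: ts_seg_compact.
have [Mp hp] := compact_within_bounded cK pc.
have [Mq hq] := compact_within_bounded cK qc.
have pqM t : K t -> p t + q t <= Mp + Mq.
  by move=> Kt; apply: lerD; apply: le_trans (ler_norm _) _; [exact: hp|exact: hq].
exists (perron (Mp + Mq)); split.
- exact: perron_primitive.
- exact: perron_init.
- exact: perron_nondecreasing.
Qed.

End existence.

End primitives.

(** * The integral and the exponential *)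

Section delta_integral.
Variables (R : realType) (T : set R) (c d : R).
Hypotheses (Tc : closed T) (Tc0 : T c) (Td : T d) (cd : c <= d).
Let K := ts_seg T c d.

Let Kc : K c. Proof. by apply/ts_segP. Qed.
Let Kd : K d. Proof. by apply/ts_segP. Qed.

Lemma delta_primitive_exists (g : R -> R) (y0 : R) :
  {within K, continuous g} -> (forall t, K t -> 0 <= g t) -> 0 <= y0 ->
  exists F, [/\ delta_primitive T c d g F, F c = y0 &
    forall s t, K s -> K t -> s <= t -> F s <= F t].
Proof.
move=> gc g0 y00.
have [||F [Fg Fc Fnd]] := linear_delta_eq_exists (p := fun=> 0) Tc Tc0 Td cd _ gc _ g0 y00.
- by apply: continuous_subspaceT => x; exact: cvg_cst.
- by [].
exists F; split=> //.
by apply: eq_delta_primitive Fg => t _ _; rewrite mul0r add0r.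
Qed.

Lemma delta_int_eq (g F : R -> R) :
  delta_primitive T c d g F -> delta_int T g c d = F d - F c.
Proof.
move=> Fg; apply: xget_unique; first by exists F.
move=> _ [G [Gg ->]].
have le (H1 H2 : R -> R) : delta_primitive T c d g H1 ->
    delta_primitive T c d g H2 -> H1 d - H1 c <= H2 d - H2 c.
  move=> h1 h2.
  have h3 := delta_primitive_lin 1 (H1 c - H2 c) h2 (delta_primitive_cst T c d 1).
  have := delta_primitive_le (p := fun=> 0) (M := 0) Tc Tc0 Td cd h1 h3 _ _ Kd.
  move=> h; suff : H1 d <= 1 * H2 d + (H1 c - H2 c) * 1 by lra.
  apply: h; first by lra.
  by move=> t _ _; rewrite lexx; split=> //; lra.
by apply/eqP; rewrite eq_le !le.
Qed.

Lemma delta_exp_eq (p y : R -> R) (M : R) :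
  (forall t, K t -> 0 <= p t <= M) ->
  delta_primitive T c d (fun s => p s * y s) y -> y c = 1 ->
  delta_exp T p d c = y d.
Proof.
move=> pM yp yc; apply: xget_unique; first by exists y.
move=> _ [z [zp zc ->]].
have le (H1 H2 : R -> R) : delta_primitive T c d (fun s => p s * H1 s) H1 ->
    delta_primitive T c d (fun s => p s * H2 s) H2 -> H1 c <= H2 c ->
    H1 d <= H2 d.
  move=> h1 h2 h12.
  apply: (delta_primitive_le (p := p) (M := M) Tc Tc0 Td cd h1 h2 h12 _ Kd).
  by move=> t Kt _; split; [exact: pM|lra].
by apply/eqP; rewrite eq_le; apply/andP; split; apply: le => //; rewrite yc zc.
Qed.

(** The additive error e serves for the continuity of parametric integrals. *)
Lemma delta_int_le_add (g h : R -> R) (e : R) :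
  {within K, continuous g} -> {within K, continuous h} ->
  (forall t, K t -> 0 <= g t) -> (forall t, K t -> 0 <= h t) ->
  (forall t, K t -> g t <= h t + e) ->
  delta_int T g c d <= delta_int T h c d + e * (d - c).
Proof.
move=> gc hc g0 h0 gh.
have [G [Gg Gc _]] := delta_primitive_exists gc g0 (lexx 0).
have [H [Hh Hc _]] := delta_primitive_exists hc h0 (lexx 0).
rewrite (delta_int_eq Gg) (delta_int_eq Hh) Gc Hc.
have := delta_primitive_lin 1 e Hh (delta_primitive_id T c d).
move/(delta_primitive_lin 1 (- (e * c)))/(_ (delta_primitive_cst T c d 1)) => He.
suff : G d <= 1 * (1 * H d + e * d) + - (e * c) * 1 by lra.
apply: (delta_primitive_le (p := fun=> 0) (M := 0) Tc Tc0 Td cd Gg He) => //.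
  rewrite Gc Hc; lra.
by move=> t Kt _; rewrite lexx; split=> //; have := gh t Kt; lra.
Qed.

Lemma delta_int_ge0 (g : R -> R) :
  {within K, continuous g} -> (forall t, K t -> 0 <= g t) ->
  0 <= delta_int T g c d.
Proof.
move=> gc g0.
have [G [Gg Gc Gnd]] := delta_primitive_exists gc g0 (lexx 0).
by rewrite (delta_int_eq Gg) subr_ge0; exact: Gnd.
Qed.

Lemma delta_intZ (k : R) (g : R -> R) :
  {within K, continuous g} -> (forall t, K t -> 0 <= g t) ->
  delta_int T (fun s => g s * k) c d = delta_int T g c d * k.
Proof.
move=> gc g0.
have [G [Gg Gc Gnd]] := delta_primitive_exists gc g0 (lexx 0).
have kG := delta_primitive_lin k 0 Gg Gg.
rewrite (delta_int_eq Gg).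
have kG' : delta_primitive T c d (fun s => g s * k)
    (fun s => k * G s + 0 * G s).
  by apply: eq_delta_primitive kG => t _ _; ring.
by rewrite (delta_int_eq kG'); ring.
Qed.

(** By compactness of [c, d], k s' is uniformly close to k s on [c, d] for s' near s,
so their integrals differ by at most that distance times d - c. *)
Lemma delta_int_continuous (A : set R) (k : R -> R -> R) :
  {within A `*` K, continuous (fun z : R * R => k z.1 z.2)} ->
  (forall s x, A s -> K x -> 0 <= k s x) ->
  {within A, continuous (fun s => delta_int T (k s) c d)}.
Proof.
move=> kc k0.
have kcs s : A s -> {within K, continuous (k s)} by exact: within_continuous_slice.
apply/within_continuous_leP => s As e e0.
have cd0 : 0 < d - c + 1 by rewrite ltr_wpDl// subr_ge0.
pose e' := e / (d - c + 1).
have e'0 : 0 < e' by exact: divr_gt0.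
have e'2 : 0 < e' / 2 by exact: divr_gt0.
have near_k : \forall s' \near s, forall x, K x -> A s' -> `|k s x - k s' x| <= e'.
  have cK : compact K by exact: ts_seg_compact.
  move/compact_near_coveringP : cK.
  move=> /(_ _ (nbhs s) (fun s' x => K x -> A s' -> `|k s x - k s' x| <= e') _).
  move=> H; have {}H := H _; apply: filterS (H _) => [s' Hs' x Kx|]; first exact: Hs'.
  move=> x Kx.
  have /within_continuous_leP /(_ (s, x) (conj As Kx) _ e'2) [/= [V1 V2]] := kc.
  move=> /= [V1s V2x] V12.
  exists (V2, V1) => //= -[x' s'] /= [V2x' V1s'] Kx' As'.
  have h1 := V12 (s', x') (conj V1s' V2x') (conj As' Kx').
  have h2 := V12 (s, x') (conj (nbhs_singleton V1s) V2x') (conj As Kx').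
  move: h1 h2 => /= h1 h2.
  have -> : k s x' - k s' x' = (k s x - k s' x') - (k s x - k s x') by ring.
  apply: le_trans (ler_normB _ _) _; lra.
apply: filterS near_k => s' Hs' As'.
have e'e : e' * (d - c) <= e.
  have : e' * (d - c + 1) = e by rewrite divfK// gt_eqF.
  lra.
have le1 : delta_int T (k s) c d <= delta_int T (k s') c d + e' * (d - c).
  apply: delta_int_le_add; [exact: kcs|exact: kcs|move=> ?; exact: k0|move=> ?; exact: k0|].
  by move=> x Kx; have := Hs' x Kx As'; rewrite ler_norml => /andP[]; lra.
have le2 : delta_int T (k s') c d <= delta_int T (k s) c d + e' * (d - c).
  apply: delta_int_le_add; [exact: kcs|exact: kcs|move=> ?; exact: k0|move=> ?; exact: k0|].
  by move=> x Kx; have := Hs' x Kx As'; rewrite ler_norml => /andP[]; lra.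
rewrite ler_norml; apply/andP; split; lra.
Qed.

End delta_integral.

(** Both the monotonicity of the integral in the integrand and, for a nonnegative
integrand, its monotonicity in the upper endpoint. *)
Lemma delta_int_le_extend (R : realType) (T : set R) (c d e : R) (g h : R -> R) :
  closed T -> T c -> T d -> T e -> c <= e -> e <= d ->
  {within ts_seg T c e, continuous g} -> {within ts_seg T c d, continuous h} ->
  (forall t, ts_seg T c e t -> 0 <= g t) ->
  (forall t, ts_seg T c d t -> 0 <= h t) ->
  (forall t, ts_seg T c e t -> g t <= h t) ->
  delta_int T g c e <= delta_int T h c d.
Proof.
move=> Tc Tc0 Td Te ce ed gc hc g0 h0 gh.
have cd := le_trans ce ed.
have [H [Hh Hc Hnd]] := delta_primitive_exists Tc Tc0 Td cd hc h0 (lexx 0).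
have He := delta_primitive_restrict Te ce ed Hh.
have sub : ts_seg T c e `<=` ts_seg T c d.
  move=> x /ts_segP[Tx cx xe]; apply/ts_segP; split=> //; exact: le_trans ed.
apply: (@le_trans _ _ (delta_int T h c e)).
  have := @delta_int_le_add _ T c e Tc Tc0 Te ce g h 0 gc.
  rewrite mul0r addr0; apply=> //; first exact: continuous_subspaceW hc.
    by move=> t /sub; exact: h0.
  by move=> t /gh; rewrite addr0.
rewrite (delta_int_eq Tc Tc0 Te ce He) (delta_int_eq Tc Tc0 Td cd Hh).
by rewrite lerD2r; apply: Hnd => //; apply/ts_segP.
Qed.

(** * The inequality *)

Theorem theorem129 (R : realType) (T1 T2 : set R) (a1 a2 : R)
    (u a : R -> R -> R) (f : R -> R -> R -> R -> R)
    (hT1 : time_scale T1) (hT2 : time_scale T2)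
    (ha1 : T1 a1) (ha2 : T2 a2)
    (u_cont : {within ts_from T1 a1 `*` ts_from T2 a2,
                 continuous (fun z : R * R => u z.1 z.2)})
    (u_ge0 : forall t1 t2, ts_from T1 a1 t1 -> ts_from T2 a2 t2 ->
       0 <= u t1 t2)
    (a_cont : {within ts_from T1 a1 `*` ts_from T2 a2,
                 continuous (fun z : R * R => a z.1 z.2)})
    (a_ge0 : forall t1 t2, ts_from T1 a1 t1 -> ts_from T2 a2 t2 ->
       0 <= a t1 t2)
    (a_mono1 : forall t1 t1' t2,
       ts_from T1 a1 t1 -> ts_from T1 a1 t1' -> ts_from T2 a2 t2 ->
       t1 <= t1' -> a t1 t2 <= a t1' t2)
    (a_mono2 : forall t1 t2 t2',
       ts_from T1 a1 t1 -> ts_from T2 a2 t2 -> ts_from T2 a2 t2' ->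
       t2 <= t2' -> a t1 t2 <= a t1 t2')
    (f_cont : {within kernel_domain T1 T2 a1 a2,
                 continuous (fun z : R * R * R * R =>
                               f z.1.1.1 z.1.1.2 z.1.2 z.2)})
    (f_ge0 : forall t1 t2 s1 s2,
       kernel_domain T1 T2 a1 a2 (t1, t2, s1, s2) -> 0 <= f t1 t2 s1 s2)
    (f_mono1 : forall t1 t1' t2 s1 s2,
       kernel_domain T1 T2 a1 a2 (t1, t2, s1, s2) ->
       kernel_domain T1 T2 a1 a2 (t1', t2, s1, s2) ->
       t1 <= t1' -> f t1 t2 s1 s2 <= f t1' t2 s1 s2)
    (f_mono2 : forall t1 t2 t2' s1 s2,
       kernel_domain T1 T2 a1 a2 (t1, t2, s1, s2) ->
       kernel_domain T1 T2 a1 a2 (t1, t2', s1, s2) ->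
       t2 <= t2' -> f t1 t2 s1 s2 <= f t1 t2' s1 s2)
    (u_le : forall t1 t2, ts_from T1 a1 t1 -> ts_from T2 a2 t2 ->
       u t1 t2 <= a t1 t2 +
         delta_int T1 (fun s1 =>
           delta_int T2 (fun s2 => f t1 t2 s1 s2 * u s1 s2) a2 t2) a1 t1) :
  forall t1 t2, ts_from T1 a1 t1 -> ts_from T2 a2 t2 ->
    let p := fun tau => delta_int T2 (fun s2 => f t1 t2 tau s2) a2 t2 in
    u t1 t2 <= a t1 t2 * delta_exp T1 p t1 a1.
Proof.
have [_ T1c] := hT1; have [_ T2c] := hT2.
move=> t1 t2 ht1 ht2 /=.
set p := fun tau => delta_int T2 _ a2 t2.
have [Tt1 at1] : T1 t1 /\ a1 <= t1 by move: ht1 => [? /=]; rewrite in_itv/= andbT.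
have [Tt2 at2] : T2 t2 /\ a2 <= t2 by move: ht2 => [? /=]; rewrite in_itv/= andbT.
pose K1 := ts_seg T1 a1 t1; pose K2 := ts_seg T2 a2 t2.
have from1 s x : ts_seg T1 a1 s x -> ts_from T1 a1 x.
  by move=> /ts_segP[Tx ax _]; split=> //=; rewrite in_itv/= ax.
have from2 s x : ts_seg T2 a2 s x -> ts_from T2 a2 x.
  by move=> /ts_segP[Tx ax _]; split=> //=; rewrite in_itv/= ax.
have dom s x s1 s2 : ts_from T1 a1 s -> ts_from T2 a2 x -> ts_seg T1 a1 s s1 ->
    ts_seg T2 a2 x s2 -> kernel_domain T1 T2 a1 a2 (s, x, s1, s2).
  move=> hs hx h1 h2; split=> //; [exact: from1 _ _ h1|exact: from2 _ _ h2|].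
  by case/ts_segP: h1 => _ -> ->; case/ts_segP: h2 => _ -> ->.
have fc s x : ts_from T1 a1 s -> ts_from T2 a2 x ->
    {within ts_seg T1 a1 s `*` ts_seg T2 a2 x,
      continuous (fun z : R * R => f s x z.1 z.2)}.
  move=> hs hx.
  apply: (within_continuous_comp_sub (f := fun z : R * R => (s, x, z.1, z.2))
           _ _ f_cont).
    move=> z; apply: (@cvg_pair _ _ _ (nbhs z) (nbhs (s, x, z.1)) (nbhs z.2) _ _ _
      (fun z : R * R => (s, x, z.1)) (fun z => z.2)); last exact: cvg_snd.
    by apply: (@cvg_pair _ _ _ (nbhs z) (nbhs (s, x)) (nbhs z.1) _ _ _
      (fun=> (s, x)) (fun z => z.1)); [exact: cvg_cst|exact: cvg_fst].
  by move=> z [/= h1 h2]; exact: dom.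
have fuc s x : ts_from T1 a1 s -> ts_from T2 a2 x ->
    {within ts_seg T1 a1 s `*` ts_seg T2 a2 x,
      continuous (fun z : R * R => f s x z.1 z.2 * u z.1 z.2)}.
  move=> hs hx; have /subspace_continuousP fsx := fc s x hs hx.
  have /subspace_continuousP uc : {within ts_seg T1 a1 s `*` ts_seg T2 a2 x,
      continuous (fun z : R * R => u z.1 z.2)}.
    apply: continuous_subspaceW u_cont => z [/= h1 h2].
    by split; [exact: from1 _ _ h1|exact: from2 _ _ h2].
  by apply/subspace_continuousP => z Az; apply: cvgM; [exact: fsx|exact: uc].
have f0 s x s1 s2 : ts_from T1 a1 s -> ts_from T2 a2 x -> ts_seg T1 a1 s s1 ->
    ts_seg T2 a2 x s2 -> 0 <= f s x s1 s2.
  by move=> hs hx h1 h2; apply: f_ge0; exact: dom.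
have fu0 s x s1 s2 : ts_from T1 a1 s -> ts_from T2 a2 x -> ts_seg T1 a1 s s1 ->
    ts_seg T2 a2 x s2 -> 0 <= f s x s1 s2 * u s1 s2.
  move=> hs hx h1 h2; rewrite mulr_ge0 ?f0// u_ge0//.
    exact: from1 _ _ h1.
  exact: from2 _ _ h2.
have pc : {within K1, continuous p}.
  apply: (delta_int_continuous T2c ha2 Tt2 at2 (k := f t1 t2) (A := K1)).
    exact: fc.
  by move=> s x; exact: f0.
have p0 s : K1 s -> 0 <= p s.
  move=> Ks; apply: (delta_int_ge0 T2c ha2 Tt2 at2).
    exact: (within_continuous_slice (fc _ _ ht1 ht2) Ks).
  by move=> x Kx; exact: f0.
have [M pM] := compact_within_bounded (@ts_seg_compact _ _ a1 t1 T1c) pc.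
have pM' s : K1 s -> 0 <= p s <= M.
  by move=> Ks; rewrite p0// (le_trans (ler_norm _) (pM s Ks)).
have [y yp y1] : exists2 y,
    delta_primitive T1 a1 t1 (fun s => p s * y s) y & y a1 = 1.
  have c0 : {within K1, continuous (fun=> 0 : R)}.
    by apply: continuous_subspaceT => x; exact: cvg_cst.
  have [//|F [Fp F1 _]] := linear_delta_eq_exists T1c ha1 Tt1 at1 pc c0 p0 _ ler01.
  exists F => //; apply: eq_delta_primitive Fp => t _ _; exact: addr0.
rewrite (delta_exp_eq T1c ha1 Tt1 at1 pM' yp y1).
(* The majorant Z: the primitive of g that starts from a t1 t2. *)
pose A := a t1 t2.
pose g s := delta_int T2 (fun x => f t1 t2 s x * u s x) a2 t2.
have gc : {within K1, continuous g}.
  apply: (delta_int_continuous T2c ha2 Tt2 at2 (A := K1)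
    (k := fun s x => f t1 t2 s x * u s x)).
    exact: fuc.
  by move=> s x; exact: fu0.
have g0 s : K1 s -> 0 <= g s.
  move=> Ks; apply: (delta_int_ge0 T2c ha2 Tt2 at2).
    exact: (within_continuous_slice (k := fun s x => f t1 t2 s x * u s x)
              (fuc _ _ ht1 ht2) Ks).
  by move=> x Kx; exact: fu0.
have A0 : 0 <= A by exact: a_ge0.
have [Z [Zg Z0 _]] := delta_primitive_exists T1c ha1 Tt1 at1 gc g0 A0.
(* Monotonicity replaces (s, x) by (t1, t2) in a, in the kernel and in the upper
   endpoint of the inner integral; the endpoint of the outer one remains s. *)
have uZ s x : K1 s -> K2 x -> u s x <= Z s.
  move=> Ks Kx; have hs := from1 _ _ Ks; have hx := from2 _ _ Kx.
  have [Ts as_ st1] := (ts_segP _ _ _ _).1 Ks.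
  have [Tx ax xt2] := (ts_segP _ _ _ _).1 Kx.
  apply: le_trans (u_le s x hs hx) _.
  have -> : Z s = A + (Z s - Z a1) by rewrite Z0; ring.
  apply: lerD; first by apply: le_trans (a_mono1 s t1 x hs ht1 hx st1) (a_mono2 _ _ _ ht1 hx ht2 xt2).
  rewrite -(delta_int_eq T1c ha1 Ts as_ (delta_primitive_restrict Ts as_ st1 Zg)).
  have sub1 : ts_seg T1 a1 s `<=` K1.
    by move=> r /ts_segP[? ? rs]; apply/ts_segP; split=> //; exact: le_trans st1.
  have sub2 : ts_seg T2 a2 x `<=` K2.
    by move=> r /ts_segP[? ? rs]; apply/ts_segP; split=> //; exact: le_trans xt2.
  apply: (delta_int_le_extend T1c ha1 Ts Ts as_ (lexx s)).
  - apply: (delta_int_continuous T2c ha2 Tx ax (A := ts_seg T1 a1 s)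
      (k := fun s1 s2 => f s x s1 s2 * u s1 s2)).
      exact: fuc.
    by move=> ? ?; exact: fu0.
  - exact: continuous_subspaceW gc.
  - move=> r Kr; apply: (delta_int_ge0 T2c ha2 Tx ax).
      exact: (within_continuous_slice (k := fun s1 s2 => f s x s1 s2 * u s1 s2)
              (fuc _ _ hs hx) Kr).
    by move=> ? ?; exact: fu0.
  - by move=> r /sub1; exact: g0.
  move=> r Kr; have K1r := sub1 r Kr.
  apply: (delta_int_le_extend T2c ha2 Tt2 Tx ax xt2).
  - exact: (within_continuous_slice (k := fun s1 s2 => f s x s1 s2 * u s1 s2)
              (fuc _ _ hs hx) Kr).
  - exact: (within_continuous_slice (k := fun s1 s2 => f t1 t2 s1 s2 * u s1 s2)
              (fuc _ _ ht1 ht2) K1r).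
  - by move=> ? ?; exact: fu0.
  - by move=> ? ?; exact: fu0.
  move=> v Kv; have K2v := sub2 v Kv.
  apply: ler_wpM2r.
    by apply: u_ge0; [exact: from1 _ _ Kr|exact: from2 _ _ Kv].
  have st2 : ts_seg T1 a1 s r by [].
  have mid : kernel_domain T1 T2 a1 a2 (t1, x, r, v) by exact: dom.
  apply: le_trans (f_mono1 s t1 x r v _ mid st1) _; first exact: dom.
  by apply: f_mono2 xt2; [|exact: dom].
(* Here u s x <= Z s is used for all x up to t2, and Z s comes out of the inner
   integral. *)
have gp s : K1 s -> g s <= p s * Z s.
  move=> Ks; have hs := from1 _ _ Ks.
  have kc := within_continuous_slice (fc _ _ ht1 ht2) Ks.
  have k0 x : K2 x -> 0 <= f t1 t2 s x by move=> Kx; exact: f0.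
  have Z0s : 0 <= Z s.
    have Ka2 : K2 a2 by apply/ts_segP.
    by apply: le_trans (uZ s a2 Ks Ka2); apply: u_ge0 => //; exact: from2 _ _ Ka2.
  rewrite -(delta_intZ T2c ha2 Tt2 at2 (Z s) kc k0).
  apply: (delta_int_le_extend T2c ha2 Tt2 Tt2 at2 (lexx t2)).
  - exact: (within_continuous_slice (k := fun s1 s2 => f t1 t2 s1 s2 * u s1 s2)
              (fuc _ _ ht1 ht2) Ks).
  - move/subspace_continuousP : kc => kc; apply/subspace_continuousP => x Kx.
    by apply: cvgM; [exact: kc|exact: cvg_cst].
  - by move=> ? ?; exact: fu0.
  - by move=> x Kx; rewrite mulr_ge0// k0.
  by move=> x Kx; apply: ler_wpM2l; [exact: k0|exact: uZ].
have Kt1 : K1 t1 by apply/ts_segP.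
have Kt2 : K2 t2 by apply/ts_segP.
apply: le_trans (uZ _ _ Kt1 Kt2) _.
have Ay := delta_primitive_lin A 0 yp yp.
suff : Z t1 <= A * y t1 + 0 * y t1 by rewrite mul0r addr0.
apply: (delta_primitive_le (p := p) (M := M) T1c ha1 Tt1 at1 Zg Ay _ _ Kt1).
  by rewrite Z0 y1; lra.
by move=> s Ks _; split; [exact: pM'|have := gp s Ks; lra].
Qed.
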